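(* Let $T$ be an Aronszajn tree and let $G$ be a sparse $T$-graph with the following property: for every $t \in T$ there is a finite set $S_t \subseteq \{s \in T : s < t\}$ such that every $t' > t$ has all its down-neighbours (in $G$) that lie below $t$ inside $S_t$. Then the ray inflation $G \sharp \mathbb{N}$ witnesses that $\mathrm{HC}(\aleph_1)$ fails: it has an end $\varepsilon$ of degree $\aleph_1$ such that no set of $\aleph_1$ pairwise disjoint rays in $\varepsilon$ admits a connected ray graph in $G\sharp\mathbb{N}$.
   Context: An order tree is a partial order $(T,\le)$ with a unique minimal element (the root) in which every set $\lceil t\rceil=\{t' : t' \le t\}$ is well-ordered. The height of $t$ is the order type of $\{t' : t'<t\}$; the $i$-th level $T^i$ is the set of points of height $i$; a branch is a maximal chain. $t$ is a successor of $t'$ (and $t'$ its predecessor) if $t'<t$ with nothing strictly between; a point with no predecessor is a limit. An Aronszajn tree is an order tree of cardinality $\aleph_1$ all of whose branches and levels are countable. A $T$-graph is a graph $G$ with $V(G)=T$ such that the endvertices of every edge are comparable in $T$ and, for every $t$, the set of neighbours of $t$ below $t$ (its down-neighbours) is cofinal in $\{s : s<t\}$. $G$ is sparse if for every $t$ the set of down-neighbours of $t$ has order type $\mathrm{cf}(\{s : s<t\})$; for trees of height at most $\omega_1$ this means a successor's unique down-neighbour is its predecessor and the down-neighbours of a non-root limit form a cofinal $\omega$-sequence below it. For such $G$ (with $T$ of height at most $\omega_1$), the ray inflation $G\sharp\mathbb{N}$ has vertex set $T\times\mathbb{N}$ and edges: $(t,n)(t,n+1)$ for all $t,n$; $(t,n)(t',n)$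 for all $n$ whenever $t$ is a successor with predecessor $t'$; and $(t,n)(t_n,n)$ for all $n$ whenever $t$ is a non-root limit with down-neighbours $t_0<t_1<t_2<\cdots$. A ray is a one-way infinite path; two rays are equivalent if joined by infinitely many disjoint paths; ends are equivalence classes; the degree of an end is the maximal cardinality of a set of disjoint rays in it. Given a set $\mathcal{R}$ of disjoint equivalent rays, a graph $H$ on $\mathcal{R}$ is a ray graph if there is a set $\mathcal{P}$ of independent paths (no inner vertex of one on another), each meeting $\bigcup\mathcal{R}$ exactly in its endvertices, such that for every edge $RS$ of $H$ there are infinitely many disjoint $R$--$S$ paths in $\mathcal{P}$. $\mathrm{HC}(\kappa)$ states that every end of degree $\kappa$ of every graph contains $\kappa$ disjoint rays admitting a connected ray graph. *)

(* Defs.v *)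
From Stdlib Require Import List Relations.
Import ListNotations.

Definition countable_set {X : Type} (A : X -> Prop) : Prop :=
  exists f : X -> nat, forall x y, A x -> A y -> f x = f y -> x = y.

Definition countable_type (X : Type) : Prop :=
  exists f : X -> nat, forall x y, f x = f y -> x = y.

(* |X| <= aleph_1 : X carries a (strict) well-order all of whose proper
   initial segments are countable (i.e. of order type <= omega_1). *)
Definition card_le_aleph1 (X : Type) : Prop :=
  exists R : X -> X -> Prop,
    (forall x, ~ R x x) /\
    (forall x y z, R x y -> R y z -> R x z) /\
    (forall x y, R x y \/ x = y \/ R y x) /\
    well_founded R /\
    (forall x, countable_set (fun y => R y x)).

Definition card_aleph1 (X : Type) : Prop :=
  card_le_aleph1 X /\ ~ countable_type X.

Section Trees.
Context {T : Type} (le : T -> T -> Prop).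

Definition lt (s t : T) : Prop := le s t /\ s <> t.

Definition partial_order : Prop :=
  (forall x, le x x) /\
  (forall x y, le x y -> le y x -> x = y) /\
  (forall x y z, le x y -> le y z -> le x z).

Definition minimal (r : T) : Prop := forall t, le t r -> t = r.

Definition downset_well_ordered (t : T) : Prop :=
  (forall a b, le a t -> le b t -> le a b \/ le b a) /\
  (forall P : T -> Prop, (exists a, P a /\ le a t) ->
      exists m, P m /\ le m t /\ forall a, P a -> le a t -> le m a).

Definition order_tree : Prop :=
  partial_order /\
  (exists r, minimal r /\ forall r', minimal r' -> r' = r) /\
  (forall t, downset_well_ordered t).

Definition below (t : T) : T -> Prop := fun s => lt s t.

Definition order_iso (A B : T -> Prop) : Prop :=
  exists f g : T -> T,
    (forall x, A x -> B (f x)) /\ (forall y, B y -> A (g y)) /\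
    (forall x, A x -> g (f x) = x) /\ (forall y, B y -> f (g y) = y) /\
    (forall x y, A x -> A y -> (le x y <-> le (f x) (f y))).

(* the level of t: all points whose height (order type of the set of
   points strictly below) equals the height of t *)
Definition level (t : T) : T -> Prop :=
  fun t' => order_iso (below t) (below t').

Definition chain (C : T -> Prop) : Prop :=
  forall a b, C a -> C b -> le a b \/ le b a.

Definition branch (C : T -> Prop) : Prop :=
  chain C /\ forall D, chain D -> (forall x, C x -> D x) -> forall x, D x -> C x.

Definition aronszajn_tree : Prop :=
  order_tree /\ card_aleph1 T /\
  (forall C, branch C -> countable_set C) /\
  (forall t, countable_set (level t)).

Definition is_pred (t' t : T) : Prop :=
  lt t' t /\ forall u, lt t' u -> lt u t -> False.

Definition is_limit (t : T) : Prop := ~ exists t', is_pred t' t.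

Definition is_root (t : T) : Prop := minimal t.

Definition nonroot_limit (t : T) : Prop := is_limit t /\ ~ is_root t.

Variable G : T -> T -> Prop.

Definition simple_graph {V : Type} (E : V -> V -> Prop) : Prop :=
  (forall x y, E x y -> E y x) /\ (forall x, ~ E x x).

Definition down_nb (t s : T) : Prop := G s t /\ lt s t.

Definition T_graph : Prop :=
  simple_graph G /\
  (forall x y, G x y -> le x y \/ le y x) /\
  (forall t s, lt s t -> exists u, le s u /\ down_nb t u).

(* sparse, in the form stated for trees of height <= omega_1:
   a successor's only down-neighbour is its predecessor; the down-neighbours
   of a non-root limit form an increasing omega-sequence (cofinality is
   already part of T_graph). *)
Definition sparse : Prop :=
  (forall t t', is_pred t' t -> forall s, down_nb t s <-> s = t') /\
  (forall t, nonroot_limit t ->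
     exists f : nat -> T, (forall n, lt (f n) (f (S n))) /\
        (forall s, down_nb t s <-> exists n, f n = s)).

(* s is the n-th (from 0) down-neighbour of t in increasing order *)
Definition nth_down (t : T) (n : nat) (s : T) : Prop :=
  down_nb t s /\
  exists l : list T, NoDup l /\ length l = n /\
     forall u, In u l <-> (down_nb t u /\ lt u s).

Definition inflation_base (a b : T * nat) : Prop :=
  (fst b = fst a /\ snd b = S (snd a)) \/
  (snd b = snd a /\ is_pred (fst b) (fst a)) \/
  (snd b = snd a /\ nonroot_limit (fst a) /\ nth_down (fst a) (snd a) (fst b)).

Definition ray_inflation (a b : T * nat) : Prop :=
  inflation_base a b \/ inflation_base b a.

End Trees.

Section Graphs.
Context {V : Type} (E : V -> V -> Prop).

Definition is_ray (r : nat -> V) : Prop :=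
  (forall i j, r i = r j -> i = j) /\ (forall i, E (r i) (r (S i))).

Fixpoint adj_chain (p : list V) : Prop :=
  match p with
  | x :: ((y :: _) as q) => E x y /\ adj_chain q
  | _ => True
  end.

Definition is_path (p : list V) : Prop :=
  p <> [] /\ NoDup p /\ adj_chain p.

Definition first (p : list V) : option V := hd_error p.
Definition final (p : list V) : option V := hd_error (rev p).

Definition AB_path (A B : V -> Prop) (p : list V) : Prop :=
  is_path p /\
  exists x y, first p = Some x /\ final p = Some y /\ A x /\ B y /\
    (forall v, In v p -> A v -> v = x) /\ (forall v, In v p -> B v -> v = y).

Definition range (r : nat -> V) : V -> Prop := fun v => exists i, r i = v.

Definition disjoint_lists (p q : list V) : Prop :=
  forall v, In v p -> In v q -> False.

Definition ray_equiv (r s : nat -> V) : Prop :=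
  exists P : nat -> list V,
    (forall k, AB_path (range r) (range s) (P k)) /\
    (forall k l, k <> l -> disjoint_lists (P k) (P l)).

(* a family of pairwise disjoint rays (as a set of rays: indexing is
   injective because distinct indices give disjoint rays) *)
Definition disjoint_rays {I : Type} (R : I -> nat -> V) : Prop :=
  (forall i, is_ray (R i)) /\
  (forall i j, i <> j -> forall m n, R i m <> R j n).

(* the end of the ray r0 (its equivalence class) has degree aleph_1 *)
Definition end_degree_aleph1 (r0 : nat -> V) : Prop :=
  (exists (I : Type) (R : I -> nat -> V),
      card_aleph1 I /\ disjoint_rays R /\ (forall i, ray_equiv (R i) r0)) /\
  (forall (I : Type) (R : I -> nat -> V),
      disjoint_rays R -> (forall i, ray_equiv (R i) r0) -> card_le_aleph1 I).

Definition inner (p : list V) (v : V) : Prop :=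
  In v p /\ first p <> Some v /\ final p <> Some v.

Definition ray_graph {I : Type} (R : I -> nat -> V) (H : I -> I -> Prop) : Prop :=
  exists Pset : list V -> Prop,
    (forall p, Pset p -> is_path p) /\
    (forall p q, Pset p -> Pset q -> p <> q ->
        forall v, inner p v -> In v q -> False) /\
    (forall p, Pset p -> forall v, In v p ->
        ((exists i n, R i n = v) <-> (first p = Some v \/ final p = Some v))) /\
    (forall i j, H i j ->
       exists f : nat -> list V,
         (forall k, Pset (f k)) /\
         (forall k, AB_path (range (R i)) (range (R j)) (f k) \/
                    AB_path (range (R j)) (range (R i)) (f k)) /\
         (forall k l, k <> l -> disjoint_lists (f k) (f l))).

Definition connected_graph {I : Type} (H : I -> I -> Prop) : Prop :=
  forall i j, clos_refl_trans I H i j.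

End Graphs.

(* Main.v *)
Require Import Defs.
From Stdlib Require Import List Relations.
From Stdlib Require Import Lia Arith Cantor Wellfounded FinFun.
From Stdlib Require Import Classical ClassicalEpsilon FunctionalExtensionality.
Import ListNotations.

(** The horizontal rays [{t} x N] are pairwise equivalent, by induction on [t]
    and because no finite set of vertices separates two of them. This gives an
    end of degree aleph_1.

    Suppose aleph_1 disjoint rays of this end had a connected ray graph. Some
    vertex [R] of it has uncountably many neighbours. Choose a countable ordinal
    sigma such that [R] lives in [T^{<sigma} x N]. As [T^{<=sigma}] is countable,
    all but countably many neighbours [R'] of [R] avoid [T^{<=sigma} x N], and so
    do the interiors of the [R]-[R'] paths. Hence [R'] and the paths without
    their first vertices live in the cone strictly above a single point [t] of
    height sigma. But only finitely many vertices of [T^{<sigma} x N] are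
    adjacent to that cone, namely some [(s, n)] with [s] in the finite set [S_t]
    and [n <= |S_t|], so that the paths cannot be infinitely many and disjoint. *)

(** * Countable sets *)

Lemma countable_sub {X : Type} (A B : X -> Prop) :
  (forall x, A x -> B x) -> countable_set B -> countable_set A.
Proof. intros AB [f Hf]; exists f; auto. Qed.

(** Choice fixes an injection into [nat] on every [B x] and one index [x] for each point [y] of the
    union. The pair of the code of [x] and the code of [y] inside [B x] then determines [y]. *)
Lemma countable_bigcup {X Y : Type} (A : X -> Prop) (B : X -> Y -> Prop) :
  countable_set A -> (forall x, A x -> countable_set (B x)) ->
  countable_set (fun y => exists x, A x /\ B x y).
Proof.
  intros [f Hf] HB.
  assert (Hg : forall x, exists g : Y -> nat,
             A x -> forall y y', B x y -> B x y' -> g y = g y' -> y = y').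
  { intro x; destruct (classic (A x)) as [Ax | nAx].
    - destruct (HB x Ax) as [g Hg]; exists g; auto.
    - exists (fun _ => 0); tauto. }
  apply choice in Hg; destruct Hg as [g Hg].
  assert (Hc : forall y, exists n,
             (exists x, A x /\ B x y) -> exists x, A x /\ B x y /\ n = to_nat (f x, g x y)).
  { intro y; destruct (classic (exists x, A x /\ B x y)) as [[x [Ax Bx]] | N].
    - exists (to_nat (f x, g x y)); eauto.
    - exists 0; tauto. }
  apply choice in Hc; destruct Hc as [c Hc].
  exists c; intros y y' Hy Hy' E.
  destruct (Hc y Hy) as (x & Ax & Bx & Ex), (Hc y' Hy') as (x' & Ax' & Bx' & Ex').
  rewrite Ex, Ex' in E; apply (f_equal of_nat) in E; rewrite !cancel_of_to in E.
  injection E as E1 E2.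
  assert (x = x') by auto; subst x'; eauto.
Qed.

Lemma countable_nat : countable_set (fun _ : nat => True).
Proof. exists (fun n => n); auto. Qed.

Lemma countable_at_most_one {X : Type} (A : X -> Prop) :
  (forall x y, A x -> A y -> x = y) -> countable_set A.
Proof. intro H; exists (fun _ => 0); auto. Qed.

Lemma countable_list {X : Type} (l : list X) : countable_set (fun x => In x l).
Proof.
  apply (countable_sub _ (fun x => exists n, True /\ nth_error l n = Some x)).
  - intros x H; destruct (In_nth_error l x H); eauto.
  - apply countable_bigcup; [apply countable_nat |].
    intros n _; apply countable_at_most_one; congruence.
Qed.

Lemma countable_union {X : Type} (A B : X -> Prop) :
  countable_set A -> countable_set B -> countable_set (fun x => A x \/ B x).
Proof.
  intros HA HB.
  apply (countable_sub _ (fun x => exists b : bool, True /\ if b then A x else B x)).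
  - intros x [H | H]; [exists true | exists false]; auto.
  - apply countable_bigcup; [| intros []; auto].
    exists (fun b : bool => if b then 0 else 1); intros [] []; congruence.
Qed.

Lemma countable_prod_nat {X : Type} (A : X -> Prop) :
  countable_set A -> countable_set (fun v : X * nat => A (fst v)).
Proof.
  intros [f Hf]; exists (fun v => to_nat (f (fst v), snd v)).
  intros [x n] [y m] Ax Ay E; cbn [fst snd] in *.
  apply (f_equal of_nat) in E; rewrite !cancel_of_to in E.
  injection E as E1 E2; f_equal; auto.
Qed.

Lemma card_le_aleph1_inj {X Y : Type} (f : Y -> X) :
  (forall y y', f y = f y' -> y = y') -> card_le_aleph1 X -> card_le_aleph1 Y.
Proof.
  intros inj (R & irr & tr & tot & wf & cnt).
  exists (fun a b => R (f a) (f b)); split; [| split; [| split; [| split]]]; eauto.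
  - intros x y; destruct (tot (f x) (f y)) as [H | [H | H]]; auto.
  - apply (wf_inverse_image _ _ R f wf).
  - intro x; destruct (cnt (f x)) as [g Hg]; exists (fun y => g (f y)); auto.
Qed.

(** In the lexicographic order, everything before [(x, n)] lies over the countable set of points up
    to and including [x]. *)
Lemma card_le_aleph1_prod_nat {X : Type} :
  card_le_aleph1 X -> card_le_aleph1 (X * nat).
Proof.
  intros (R & irr & tr & tot & wf & cnt).
  exists (fun a b => R (fst a) (fst b) \/ (fst a = fst b /\ snd a < snd b)).
  split; [| split; [| split; [| split]]].
  - intros [x n] [H | [_ H]]; [eapply irr; eauto | simpl in H; lia].
  - intros [x n] [y m] [z k]; simpl; intros [H | [H H1]] [H' | [H' H1']]; subst; eauto.
    right; split; [auto | lia].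
  - intros [x n] [y m]; simpl; destruct (tot x y) as [H | [H | H]]; auto; subst.
    destruct (lt_eq_lt_dec n m) as [[H | H] | H]; subst; auto.
  - intros [x n]; revert n; induction (wf x) as [x _ IH].
    intro n; induction (lt_wf n) as [n _ IHn].
    constructor; intros [y m] [H | [H H1]]; simpl in *; subst; auto.
  - intros [x n]; simpl.
    apply (countable_sub _ (fun v : X * nat => R (fst v) x \/ fst v = x)).
    + intros [y m]; simpl; tauto.
    + apply (countable_prod_nat (fun y => R y x \/ y = x)).
      apply countable_union; [auto | apply countable_at_most_one; congruence].
Qed.

(** The balls [B n] around a fixed vertex are countable by induction on the radius, and
    connectedness makes them exhaust [I]. Read contrapositively, an uncountable connected graph has
    a vertex with uncountably many neighbours. *)
Lemma countable_connected {I : Type} (H : I -> I -> Prop) :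
  connected_graph H -> (forall i, countable_set (H i)) -> countable_type I.
Proof.
  intros conn HH.
  assert (Hc : countable_set (fun _ : I => True)).
  { destruct (classic (exists i0 : I, True)) as [[i0 _] | N].
    2: { apply countable_at_most_one; intros x; exfalso; eauto. }
    pose (B := fix B n : I -> Prop := match n with
               | 0 => fun j => j = i0
               | S n => fun j => exists i, B n i /\ H i j end).
    apply (countable_sub _ (fun j => exists n, True /\ B n j)).
    - intros j _; pose proof (clos_rt_rtn1 _ _ _ _ (conn i0 j)) as C.
      induction C as [| y z Hyz _ [n [_ IH]]]; [exists 0; simpl; auto |].
      exists (S n); split; [auto | simpl; eauto].
    - apply countable_bigcup; [apply countable_nat |].
      intros n _; induction n; simpl.
      + apply countable_at_most_one; congruence.
      + apply countable_bigcup; auto. }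
  destruct Hc as [f Hf]; exists f; auto.
Qed.

(** Pigeonhole: the [length l + 1] distinct values of [f] from [N] on cannot all lie in [l]. *)
Lemma injection_leaves_list {X : Type} (f : nat -> X) (l : list X) (N : nat) :
  (forall i j, f i = f j -> i = j) -> exists n, N <= n /\ ~ In (f n) l.
Proof.
  intro inj; apply NNPP; intro C.
  assert (Hin : incl (map f (seq N (S (length l)))) l).
  { intros x Hx; apply in_map_iff in Hx; destruct Hx as (n & <- & Hn).
    apply in_seq in Hn; apply NNPP; intro; apply C; exists n; split; [lia | auto]. }
  apply NoDup_incl_length in Hin.
  - rewrite length_map, length_seq in Hin; lia.
  - apply Injective_map_NoDup; [exact inj | apply seq_NoDup].
Qed.

(** * Equivalence of rays by finite separators *)

Section FiniteSeparators.
Context {V : Type} (E : V -> V -> Prop).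

(** Connection by a walk that avoids [X], endvertices included. Walks may repeat vertices, so they
    can be concatenated freely; paths are extracted only at the end. *)
Inductive linked (X : list V) : V -> V -> Prop :=
| linked_refl v : ~ In v X -> linked X v v
| linked_step u v w : ~ In u X -> E u v -> linked X v w -> linked X u w.

Lemma linked_trans X u v w : linked X u v -> linked X v w -> linked X u w.
Proof. induction 1; intros; [auto | eapply linked_step; eauto]. Qed.

Lemma linked_sub X Y u v : incl Y X -> linked X u v -> linked Y u v.
Proof.
  intro HI; induction 1; [apply linked_refl | eapply linked_step]; eauto.
Qed.

Lemma linked_not_in X u v : linked X u v -> ~ In u X.
Proof. destruct 1; auto. Qed.

Lemma adj_chain_app_inv p x q :
  adj_chain E (p ++ x :: q) -> adj_chain E (p ++ [x]) /\ adj_chain E (x :: q).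
Proof.
  induction p as [| a p IH]; [simpl; auto |].
  destruct p as [| b p]; cbn in *; [tauto |].
  intros [Hab Hp]; destruct (IH Hp); auto.
Qed.

Lemma adj_chain_app p x q :
  adj_chain E (p ++ [x]) -> adj_chain E (x :: q) -> adj_chain E (p ++ x :: q).
Proof.
  induction p as [| a p IH]; [simpl; auto |].
  destruct p as [| b p]; cbn in *; [tauto |].
  intros [Hab Hp] Hq; split; [exact Hab | exact (IH Hp Hq)].
Qed.

Lemma final_app (p q : list V) x : final (p ++ x :: q) = final (x :: q).
Proof.
  unfold final; rewrite rev_app_distr; simpl.
  destruct (rev q); reflexivity.
Qed.

Lemma first_app_cons (p q q' : list V) x : first (p ++ x :: q) = first (p ++ x :: q').
Proof. destruct p; reflexivity. Qed.

Lemma final_snoc (p : list V) x : final (p ++ [x]) = Some x.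
Proof. rewrite final_app; reflexivity. Qed.

Lemma linked_walk X u v :
  linked X u v -> exists p, first p = Some u /\ final p = Some v /\ adj_chain E p /\
    forall x, In x p -> ~ In x X.
Proof.
  induction 1 as [v nv | u v w nu Euv _ (p & Hf & Hl & Hc & Hx)].
  - exists [v]; repeat split; intros x [<- | []]; auto.
  - destruct p as [| v' p]; [discriminate |].
    injection Hf as ->; exists (u :: v :: p); repeat split; auto.
    + rewrite <- Hl; exact (final_app [u] p v).
    + intros x [<- | Hin]; auto.
Qed.

(* A shortest walk is an A-B path. *)
Lemma linked_AB_path (A B : V -> Prop) X u v :
  linked X u v -> A u -> B v ->
  exists p, AB_path E A B p /\ forall x, In x p -> ~ In x X.
Proof.
  intros L Au Bv.
  pose (W := fun p => (exists a, first p = Some a /\ A a) /\ (exists b, final p = Some b /\ B b)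
                      /\ adj_chain E p /\ forall x, In x p -> ~ In x X).
  assert (Hmin : exists p, W p /\ forall q, W q -> length p <= length q).
  { destruct (linked_walk _ _ _ L) as (p & Hf & Hl & Hc & Hx).
    assert (Wp : W p) by (repeat split; eauto).
    clear - Wp; remember (length p) as n eqn:En; revert p Wp En.
    induction (lt_wf n) as [n _ IH]; intros p Wp En; subst n.
    destruct (classic (exists q, W q /\ length q < length p)) as [(q & Wq & Hq) | N].
    - eapply IH; eauto.
    - exists p; split; [auto |]; intros q Wq; destruct (le_lt_dec (length p) (length q)); auto.
      exfalso; eauto. }
  destruct Hmin as (p & ((a & Ha & Aa) & (b & Hb & Bb) & Hc & Hx) & Hmin).
  exists p; split; [| auto].
  split; [split; [| split]; auto |].
  - intros ->; discriminate.
  - apply NNPP; intro N.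
    assert (D : exists x l1 l2 l3, p = l1 ++ x :: l2 ++ x :: l3).
    { clear - N; induction p as [| y p IH]; [destruct N; constructor |].
      destruct (classic (In y p)) as [I | I].
      - apply in_split in I; destruct I as (l2 & l3 & ->); exists y, [], l2, l3; auto.
      - destruct IH as (x & l1 & l2 & l3 & ->); [intro; apply N; constructor; auto |].
        exists x, (y :: l1), l2, l3; auto. }
    destruct D as (x & l1 & l2 & l3 & ->).
    (* Cutting out the closed walk between two visits to [x] would give a shorter walk. *)
    assert (HW : W (l1 ++ x :: l3)).
    { repeat split.
      - exists a; split; auto; rewrite <- Ha; apply first_app_cons.
      - exists b; split; auto; rewrite <- Hb, !final_app.
        exact (eq_sym (final_app (x :: l2) l3 x)).
      - apply adj_chain_app_inv in Hc; destruct Hc as [Hc1 Hc2].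
        apply (adj_chain_app_inv (x :: l2)) in Hc2; apply adj_chain_app; tauto.
      - intros y Hy; apply Hx; rewrite in_app_iff in *; simpl in *.
        rewrite in_app_iff; simpl; tauto. }
    apply Hmin in HW; rewrite !length_app in HW; simpl in HW.
    rewrite length_app in HW; simpl in HW; lia.
  (* Starting at a later vertex of [A], or stopping at an earlier vertex of [B], would also shorten
     the walk. *)
  - exists a, b; repeat split; auto; intros w Hw Pw; apply in_split in Hw;
      destruct Hw as (l1 & l2 & ->); apply adj_chain_app_inv in Hc; destruct Hc as [Hc1 Hc2].
    + assert (HW : W (w :: l2)).
      { repeat split; auto.
        - exists w; auto.
        - exists b; split; auto; rewrite <- Hb; symmetry; apply final_app.
        - intros y Hy; apply Hx, in_or_app; auto. }
      apply Hmin in HW; rewrite length_app in HW; simpl in HW.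
      destruct l1; [| simpl in HW; lia].
      injection Ha; auto.
    + assert (HW : W (l1 ++ [w])).
      { repeat split; eauto.
        - exists a; split; auto; rewrite <- Ha; apply first_app_cons.
        - exists w; split; auto; apply final_snoc.
        - intros y Hy; apply Hx; rewrite in_app_iff in *; simpl in *; tauto. }
      apply Hmin in HW; rewrite !length_app in HW; simpl in HW.
      destruct l2; [| simpl in HW; lia].
      rewrite final_snoc in Hb; injection Hb; auto.
Qed.

(** Greedy construction: the set to be avoided by the next path is the union of all earlier paths,
    collected in [acc]. *)
Lemma ray_equiv_of_linked (r s : nat -> V) :
  (forall X, exists a b, linked X (r a) (s b)) -> ray_equiv E r s.
Proof.
  intro HL.
  assert (HF : forall X, exists p, AB_path E (range r) (range s) p /\ forall x, In x p -> ~ In x X).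
  { intro X; destruct (HL X) as (a & b & L).
    eapply linked_AB_path; [exact L | exists a | exists b]; auto. }
  apply choice in HF; destruct HF as [F HF].
  pose (acc := fix acc k := match k with 0 => [] | S k => F (acc k) ++ acc k end).
  assert (mono : forall k l, k < l -> incl (F (acc k)) (acc l)).
  { intros k l; induction 1; intros x Hx; simpl; apply in_or_app; auto. }
  assert (dis : forall k l, k < l -> disjoint_lists (F (acc k)) (F (acc l))).
  { intros k l Hkl v Hk Hl; apply (proj2 (HF (acc l)) v Hl), (mono k l Hkl v Hk). }
  exists (fun k => F (acc k)); split; [intro; apply HF |].
  intros k l Hkl; destruct (Nat.lt_gt_cases k l) as [H _]; destruct (H Hkl) as [H1 | H1].
  - auto.
  - intros v Hk Hl; apply (dis l k H1 v Hl Hk).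
Qed.

End FiniteSeparators.

(** * Levels of an order tree *)

Section OrderTree.
Context {T : Type} (le : T -> T -> Prop) (Htree : order_tree le).

Let le_refl x : le x x.
Proof. apply Htree. Qed.

Let le_antisym x y : le x y -> le y x -> x = y.
Proof. apply Htree. Qed.

Let le_trans x y z : le x y -> le y z -> le x z.
Proof. apply Htree. Qed.

Lemma tree_lt_le_trans x y z : lt le x y -> le y z -> lt le x z.
Proof. intros [H N] H'; split; [eauto |]; intros ->; auto. Qed.

Lemma tree_lt_trans x y z : lt le x y -> lt le y z -> lt le x z.
Proof. intros H [H' _]; eapply tree_lt_le_trans; eauto. Qed.

Lemma tree_lt_irrefl x : ~ lt le x x.
Proof. intros [_ N]; auto. Qed.

Lemma tree_lt_or_le a b t : le a t -> le b t -> lt le a b \/ le b a.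
Proof.
  intros Ha Hb; destruct Htree as (_ & _ & W).
  destruct (proj1 (W t) a b Ha Hb); auto.
  destruct (classic (a = b)) as [-> | N]; [right | left; split]; auto.
Qed.

Lemma tree_lt_wf : well_founded (lt le).
Proof.
  intro t; apply NNPP; intro N.
  destruct Htree as (_ & _ & W).
  destruct (proj2 (W t) (fun a => ~ Acc (lt le) a)) as (m & Nm & Hm & Hmin); [eauto |].
  apply Nm; constructor; intros a Ha; apply NNPP; intro Na.
  apply (tree_lt_irrefl a), (tree_lt_le_trans _ m); auto.
  apply Hmin; auto; apply (le_trans _ m); [apply Ha | auto].
Qed.

Lemma tree_root_le r t : minimal le r -> le r t.
Proof.
  intro Hr; destruct Htree as (_ & (r' & Hr' & uniq) & W).
  destruct (proj2 (W t) (fun _ => True)) as (m & _ & Hm & Hmin); [eauto |].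
  replace r with m; auto.
  rewrite (uniq r Hr); apply uniq; intros x Hx.
  apply le_antisym; auto; apply Hmin; eauto.
Qed.

Lemma level_refl t : level le t t.
Proof. exists (fun x => x), (fun x => x); repeat apply conj; auto; tauto. Qed.

Lemma level_sym s t : level le s t -> level le t s.
Proof.
  intros (f & g & Hf & Hg & gf & fg & mono); exists g, f; repeat apply conj; auto.
  intros x y Hx Hy; split; intro H.
  - apply mono; auto; rewrite !fg; auto.
  - apply mono in H; auto; rewrite !fg in H; auto.
Qed.

Lemma level_trans s t u : level le s t -> level le t u -> level le s u.
Proof.
  intros (f & g & Hf & Hg & gf & fg & mono) (f' & g' & Hf' & Hg' & gf' & fg' & mono').
  exists (fun x => f' (f x)), (fun x => g (g' x)); repeat apply conj; auto.
  - intros x Hx; rewrite gf'; auto.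
  - intros x Hx; rewrite fg; auto.
  - intros x y Hx Hy; rewrite (mono x y Hx Hy); auto.
Qed.

(** An isomorphism between the sets below [b] and [s] restricts to one between the sets below [g s']
    and [s']. *)
Lemma level_below b s s' : level le b s -> lt le s' s -> exists b', lt le b' b /\ level le b' s'.
Proof.
  intros (f & g & Hf & Hg & gf & fg & mono) Hs; exists (g s'); split; [apply Hg, Hs |].
  exists f, g; unfold below in *.
  assert (I : forall x, lt le x (g s') -> lt le x b)
    by (intros x Hx; eapply tree_lt_trans; eauto; apply Hg, Hs).
  assert (J : forall y, lt le y s' -> lt le y s) by (intros; eapply tree_lt_trans; eauto).
  repeat apply conj; auto.
  - intros x Hx; split; [rewrite <- (fg s'); auto; apply -> mono; auto; apply Hx |].
    intro E; apply (tree_lt_irrefl (g s')); rewrite <- E at 1; rewrite gf; auto.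
  - intros y Hy; split; [apply mono; auto; rewrite !fg; auto; apply Hy |].
    intro E; apply (tree_lt_irrefl s'); rewrite <- (fg s'), <- E, fg at 1; auto.
Qed.

(** A well-order is not isomorphic to a proper initial segment of itself: [h] would move [y]
    strictly down, and iterating it would give an infinite descent. *)
Lemma level_rigid y y' : lt le y y' -> ~ level le y y'.
Proof.
  intros Hy (g & h & Hg & Hh & hg & gh & mono).
  assert (C : forall x, lt le x y' -> ~ lt le (h x) x).
  { intro x; induction (tree_lt_wf x) as [x _ IH]; intros Hx Hlt.
    assert (Hhx : lt le (h x) y') by (eapply tree_lt_trans; eauto).
    apply (IH (h x) Hlt Hhx); split.
    - apply mono; auto; rewrite !gh; auto; apply Hlt.
    - intro E; apply (f_equal g) in E; rewrite !gh in E; auto.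
      rewrite E in Hlt; apply (tree_lt_irrefl _ Hlt). }
  apply (C y Hy), Hh, Hy.
Qed.

(** If instead [y'] were strictly below [y], some point strictly below [x] would share the level of
    [y'], hence of [x'], against rigidity. *)
Lemma level_mono (B : T -> Prop) x x' y y' :
  chain le B -> B y -> B y' -> level le x y -> level le x' y' -> le x x' -> le y y'.
Proof.
  intros CB By By' L L' Hx; destruct (CB y y' By By') as [H | H]; auto.
  destruct (classic (y' = y)) as [-> | N]; auto.
  destruct (level_below x y y' L) as (z & Hz & Lz); [split; auto |].
  exfalso; apply (level_rigid z x').
  - eapply tree_lt_le_trans; eauto.
  - eapply level_trans; [exact Lz | apply level_sym; auto].
Qed.

(** Points of equal level are matched; [level_mono] makes the matching monotone and the two choices
    mutually inverse. This allows heights to be compared without ordinals. *)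
Lemma order_iso_of_levels (A B : T -> Prop) :
  chain le A -> chain le B ->
  (forall x, A x -> exists y, B y /\ level le x y) ->
  (forall y, B y -> exists x, A x /\ level le x y) -> order_iso le A B.
Proof.
  intros CA CB HAB HBA.
  assert (Hf : forall x, exists y, A x -> B y /\ level le x y).
  { intro x; destruct (classic (A x)) as [H | H]; [destruct (HAB x H); eauto | exists x; tauto]. }
  assert (Hg : forall y, exists x, B y -> A x /\ level le x y).
  { intro y; destruct (classic (B y)) as [H | H]; [destruct (HBA y H); eauto | exists y; tauto]. }
  apply choice in Hf, Hg; destruct Hf as [f Hf], Hg as [g Hg].
  assert (M1 : forall x x' y y', A x -> A x' -> B y -> B y' -> level le x y -> level le x' y' ->
             (le x x' <-> le y y')).
  { intros x x' y y' Ax Ax' By By' L L'; split; intro H.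
    - apply (level_mono B x x'); auto.
    - apply (level_mono A y y'); auto using level_sym. }
  exists f, g; repeat apply conj.
  - intros x Hx; apply Hf, Hx.
  - intros y Hy; apply Hg, Hy.
  - intros x Hx; destruct (Hf x Hx) as [B1 L1], (Hg _ B1) as [A2 L2].
    apply le_antisym; eapply (M1 _ _ (f x) (f x)); auto.
  - intros y Hy; destruct (Hg y Hy) as [A1 L1], (Hf _ A1) as [B2 L2].
    apply le_antisym; eapply (M1 (g y) (g y)); auto.
  - intros x y Hx Hy; apply M1; auto; apply Hf; auto.
Qed.

Lemma below_chain t : chain le (below le t).
Proof. intros a b [Ha _] [Hb _]; destruct Htree as (_ & _ & W); apply (W t); auto. Qed.

(** The minimal points outside [D]. If [D] consists of all points of height less than sigma, this is
    the level sigma. *)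
Definition frontier (D : T -> Prop) (t : T) : Prop :=
  ~ D t /\ forall s, lt le s t -> D s.

Lemma frontier_le (D : T -> Prop) u : ~ D u -> exists t, frontier D t /\ le t u.
Proof.
  intro Nu; destruct Htree as (_ & _ & W).
  destruct (proj2 (W u) (fun a => ~ D a)) as (m & Nm & Hm & Hmin); [eauto |].
  exists m; repeat split; auto; intros s Hs; apply NNPP; intro Ns.
  apply (tree_lt_irrefl s), (tree_lt_le_trans _ m); auto.
  apply Hmin; auto; apply (le_trans _ m); [apply Hs | auto].
Qed.

(** Induction on [x]: the partner of [x] is the least point below [t'] whose level is not yet met
    strictly below [x]. *)
Lemma frontier_level_below (D : T -> Prop) t t' :
  (forall s s', D s -> level le s s' -> D s') -> frontier D t -> frontier D t' ->
  forall x, lt le x t -> exists y, lt le y t' /\ level le x y.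
Proof.
  intros DL [Nt Ht] [Nt' Ht'] x; induction (tree_lt_wf x) as [x _ IH]; intro Hx.
  assert (IH' : forall x0, lt le x0 x -> exists y, lt le y t' /\ level le x0 y).
  { intros x0 H0; apply IH; auto; eapply tree_lt_trans; eauto. }
  destruct (classic (exists m, (lt le m t' /\ ~ exists x0, lt le x0 x /\ level le x0 m) /\ le m t'))
    as [Hm | N].
  - destruct Htree as (_ & _ & W).
    destruct (proj2 (W t') _ Hm) as (m & [Hmt Nm] & _ & Hmin); clear Hm.
    exists m; split; auto; apply order_iso_of_levels; auto using below_chain.
    + intros x0 H0; destruct (IH' x0 H0) as (y & Hy & L); exists y; split; auto.
      destruct (tree_lt_or_le y m t') as [H | H]; [apply Hy | apply Hmt | exact H |].
      exfalso; apply Nm; destruct (classic (m = y)) as [-> | Ne]; [eauto |].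
      destruct (level_below x0 y m L) as (z & Hz & Lz); [split; auto |].
      exists z; split; auto; eapply tree_lt_trans; eauto.
    + intros y Hy; apply NNPP; intro Ny.
      assert (Hyt : lt le y t') by (eapply tree_lt_trans; eauto).
      apply (tree_lt_irrefl y), (tree_lt_le_trans _ m); auto.
      apply Hmin; [split; auto | apply Hyt].
  (* Without such a point, everything below [t'] is matched strictly below [x]. Then [t'] has the
     level of [x], and so lies in [D]. *)
  - exfalso; apply Nt', (DL x); auto; apply order_iso_of_levels; auto using below_chain.
    intros y Hy; apply NNPP; intro Ny; apply N; exists y; repeat split; auto; apply Hy.
Qed.

Lemma frontier_level (D : T -> Prop) t t' :
  (forall s s', D s -> level le s s' -> D s') -> frontier D t -> frontier D t' -> level le t t'.
Proof.
  intros DL Ft Ft'; apply order_iso_of_levels; auto using below_chain.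
  - eapply frontier_level_below; eauto.
  - intros y Hy; destruct (frontier_level_below D t' t DL Ft' Ft y Hy) as (x & Hx & L).
    exists x; split; auto using level_sym.
Qed.

(* The down-closure of t is extended to a branch greedily along the given
   well-order of T, in place of an appeal to Zorn's lemma. *)
Lemma branch_through t : card_le_aleph1 T -> exists C, branch le C /\ forall s, le s t -> C s.
Proof.
  intros (R & _ & _ & tot & wf & _).
  pose (comp := fun a b => le a b \/ le b a).
  (* A point is accepted when it is comparable with everything up to [t] and with every point
     accepted earlier. *)
  pose (F := fun x (rec : forall y, R y x -> Prop) =>
               (forall s, le s t -> comp s x) /\ forall y (h : R y x), rec y h -> comp y x).
  pose (C := Fix wf (fun _ => Prop) F).
  assert (HC : forall x, C x = F x (fun y _ => C y)).
  { intro x; unfold C; rewrite Fix_eq; auto.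
    intros z f g Hfg; replace g with f; auto.
    extensionality y; extensionality h; auto. }
  assert (Ct : forall s, le s t -> C s).
  { intros s Hs; rewrite HC; split.
    - intros s' Hs'; destruct Htree as (_ & _ & W); apply (W t); auto.
    - intros y _ Hy; rewrite HC in Hy; destruct (proj1 Hy s Hs); unfold comp; auto. }
  exists C; split; [split |]; auto.
  - intros a b Ca Cb; destruct (tot a b) as [H | [<- | H]]; auto.
    + rewrite HC in Cb; apply (proj2 Cb a H Ca).
    + rewrite HC in Ca; destruct (proj2 Ca b H Cb); auto.
  - intros D CD CsubD x Dx; rewrite HC; split.
    + intros s Hs; apply CD; auto.
    + intros y _ Cy; apply CD; auto.
Qed.

End OrderTree.

(** * The ray inflation of an Aronszajn tree *)

Section Aronszajn.
Context {T : Type} (le : T -> T -> Prop) (Haron : aronszajn_tree le).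

Let Htree : order_tree le.
Proof. apply Haron. Qed.

Lemma aronszajn_below_countable t : countable_set (fun s => le s t).
Proof.
  pose proof Haron as (_ & [Hc _] & Hb & _).
  destruct (branch_through le Htree t Hc) as (C & HC & HtC).
  apply (countable_sub _ C); auto.
Qed.

(** [D] is the union of the levels that meet the down-closure of [A]: countably many levels, each
    countable. It plays the part of the points of height less than sigma, and its frontier lies in a
    single level. *)
Lemma aronszajn_countable_hull (A : T -> Prop) :
  countable_set A -> exists D : T -> Prop,
    (forall x, A x -> D x) /\ (forall s s', D s -> lt le s' s -> D s') /\
    countable_set D /\ countable_set (frontier le D).
Proof.
  intro HA; pose (D := fun s => exists a, A a /\ exists b, le b a /\ level le b s).
  assert (DL : forall s s', D s -> level le s s' -> D s').
  { intros s s' (a & Ha & b & Hb & L) L'; exists a; split; auto; exists b; split; auto.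
    eapply level_trans; eauto. }
  exists D; repeat split.
  - intros x Ax; exists x; split; auto; exists x.
    split; [apply Htree | apply (level_refl le Htree)].
  - intros s s' (a & Ha & b & Hb & L) Hs; exists a; split; auto.
    destruct (level_below le Htree b s s' L Hs) as (b' & Hb' & L').
    exists b'; split; auto; eapply tree_lt_le_trans; eauto.
  - apply countable_bigcup; auto; intros a _; apply countable_bigcup.
    + apply aronszajn_below_countable.
    + intros b _; apply Haron.
  - destruct (classic (exists t, frontier le D t)) as [[t Ht] | N].
    + apply (countable_sub _ (level le t)); [| apply Haron].
      intros t' Ht'; eapply frontier_level; eauto.
    + apply countable_at_most_one; intros x y Hx; exfalso; eauto.
Qed.

Context (G : T -> T -> Prop).

Local Notation E := (ray_inflation le G).

Lemma inflation_sym u v : E u v -> E v u.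
Proof. intros [H | H]; [right | left]; auto. Qed.

Lemma inflation_comparable u v : E u v -> le (fst u) (fst v) \/ le (fst v) (fst u).
Proof.
  assert (base : forall u v, inflation_base le G u v -> le (fst u) (fst v) \/ le (fst v) (fst u)).
  { intros u' v' [[H _] | [[_ H] | [_ [_ H]]]].
    - rewrite H; left; apply Htree.
    - right; apply H.
    - right; apply H. }
  intros [H | H]; destruct (base _ _ H); auto.
Qed.

Definition column (t : T) (n : nat) : T * nat := (t, n).

Lemma column_is_ray t : is_ray E (column t).
Proof.
  split; [intros i j H; injection H; auto |].
  intro i; left; left; auto.
Qed.

Lemma column_linked X t a b :
  (forall n, min a b <= n -> ~ In (t, n) X) -> linked E X (t, a) (t, b).
Proof.
  intro HX; destruct (le_lt_dec a b) as [H | H].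
  - rewrite Nat.min_l in HX by lia; induction H as [| b Hab IH].
    + apply linked_refl, HX; lia.
    + eapply linked_trans; [exact IH |].
      apply linked_step with (t, S b); [apply HX; lia | left; left; simpl; auto |].
      apply linked_refl, HX; lia.
  - rewrite Nat.min_r in HX by lia; assert (Hle : b <= a) by lia; clear H.
    induction Hle as [| a Hle IH].
    + apply linked_refl, HX; lia.
    + apply linked_step with (t, a); [apply HX; lia | right; left; simpl; auto | exact IH].
Qed.

Lemma index_bound (X : list (T * nat)) : exists N, forall t n, In (t, n) X -> n < N.
Proof.
  exists (S (list_max (map snd X))); intros t n H.
  pose proof (proj1 (list_max_le (map snd X) _) (le_n _)) as F.
  rewrite Forall_forall in F; specialize (F n); apply Nat.lt_succ_r, F.
  apply in_map_iff; exists (t, n); auto.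
Qed.

Lemma columns_linked r :
  sparse le G -> minimal le r ->
  forall t X, exists a b, linked E X (t, a) (r, b).
Proof.
  intros [_ Hlim] Hr t; induction (tree_lt_wf le Htree t) as [t _ IH]; intro X.
  destruct (index_bound X) as [N HN].
  destruct (classic (t = r)) as [-> | Ntr].
  { exists N, N; apply linked_refl; intro H; apply HN in H; lia. }
  destruct (classic (exists t', is_pred le t' t)) as [[t' Ht'] | Nl].
  (* Forbidding the first [N] vertices of the column of [t'] as well forces [a] to be at least [N],
     so that [(t, a)] avoids [X]. *)
  - destruct (IH t' (proj1 Ht') (X ++ map (fun n => (t', n)) (seq 0 N))) as (a & b & L).
    assert (Ha : N <= a).
    { apply linked_not_in in L; destruct (le_lt_dec N a); auto.
      exfalso; apply L, in_or_app; right; apply in_map_iff; exists a; split; auto.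
      apply in_seq; lia. }
    exists a, b; apply linked_step with (t', a).
    + intro H; apply HN in H; lia.
    + left; right; left; auto.
    + eapply linked_sub; [| exact L]; intros x Hx; apply in_or_app; auto.
  - assert (Hnl : nonroot_limit le t).
    { split; auto; intro Hroot; apply Ntr; symmetry; apply Hroot.
      apply (tree_root_le le Htree); auto. }
    destruct (Hlim t Hnl) as (f & finc & Hf).
    assert (flt : forall i j, i < j -> lt le (f i) (f j)).
    { intros i j; induction 1; auto; eapply tree_lt_trans; eauto. }
    assert (finj : forall i j, f i = f j -> i = j).
    { intros i j Hij; destruct (lt_eq_lt_dec i j) as [[H | H] | H]; auto;
        apply flt in H; rewrite Hij in H; exfalso; apply (tree_lt_irrefl le Htree _ H). }
    (* This [n] is large enough for [(t, n)] to avoid [X], and the whole column of [f n] avoids [X],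
       so one may walk along it from [(f n, n)] to [(f n, a)]. *)
    destruct (injection_leaves_list f (map fst X) N finj) as (n & Hn & Hfn).
    assert (Hd : down_nb le G t (f n)) by (apply Hf; eauto).
    destruct (IH (f n) (proj2 Hd) X) as (a & b & L).
    exists n, b; apply linked_step with (f n, n).
    + intro H; apply HN in H; lia.
    + left; right; right; split; [| split; [exact Hnl | split; [exact Hd |]]]; auto.
      (* The down-neighbours of [t] below [f n] are exactly [f 0], ..., [f (n - 1)]. *)
      simpl; exists (map f (seq 0 n)); split; [| split; [| intro u; split]].
      * apply Injective_map_NoDup; [exact finj | apply seq_NoDup].
      * rewrite length_map, length_seq; auto.
      * intro H; apply in_map_iff in H; destruct H as (i & <- & Hi); apply in_seq in Hi.
        split; [apply Hf; eauto | apply flt; lia].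
      * intros [Hu Hlt]; apply Hf in Hu; destruct Hu as [i <-]; apply in_map; apply in_seq.
        destruct (le_lt_dec n i) as [Hni | Hni]; [| lia]; exfalso.
        destruct (Nat.eq_dec n i) as [<- | Ne]; [apply (tree_lt_irrefl le Htree _ Hlt) |].
        apply (tree_lt_irrefl le Htree (f i)); eapply tree_lt_trans; [eauto | exact Hlt |].
        apply flt; lia.
    + eapply linked_trans; [apply column_linked | exact L].
      intros k _ Hk; apply Hfn, in_map_iff; exists (f n, k); auto.
Qed.

(** * Ray graphs have countable degrees *)

Context (Hfin : forall t : T, exists S : list T,
      (forall s, In s S -> lt le s t) /\
      (forall t' s, lt le t t' -> down_nb le G t' s -> lt le s t -> In s S)).

Section Frontier.
Context (D : T -> Prop) (Ddown : forall s s', D s -> lt le s' s -> D s').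

Let frontier_ge t s u : frontier le D t -> le t u -> D s -> le s u -> lt le s t.
Proof.
  intros [Nt _] Htu Ds Hsu; destruct (tree_lt_or_le le Htree s t u Hsu Htu) as [H | H]; auto.
  exfalso; apply Nt; destruct (classic (t = s)) as [-> | Ne]; auto.
  apply (Ddown s); auto; split; auto.
Qed.

(** Adjacent vertices have comparable tree points, so an edge can leave the cone above [t] only to a
    point strictly below [t], and such points are in [D]. *)
Lemma cone_step t u v :
  frontier le D t -> le t (fst u) -> E u v -> ~ D (fst v) -> le t (fst v).
Proof.
  intros Ft Hu Huv Nv; destruct (inflation_comparable _ _ Huv) as [H | H].
  - apply Htree with (fst u); auto.
  - destruct (tree_lt_or_le le Htree (fst v) t (fst u) H Hu) as [H1 | H1]; auto.
    exfalso; apply Nv, Ft, H1.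
Qed.

(** A column edge would put a point above [t] into [D], and a successor edge is impossible because
    [t] lies strictly between its ends. In the remaining case, [x = (s, m)] where [s] is the
    down-neighbour number [m] of a limit above [t]. Then [s] is in [S], and so are the [m]
    down-neighbours before it, whence [m <= length S]. *)
Lemma cone_neighbours_finite t :
  frontier le D t -> exists L : list (T * nat),
    forall x u, E x u -> D (fst x) -> lt le t (fst u) -> In x L.
Proof.
  intros Ft; destruct (Hfin t) as (S & _ & HS).
  exists (list_prod S (seq 0 (Datatypes.S (length S)))).
  assert (key : forall s m u, D s -> lt le t (fst u) -> inflation_base le G u (s, m) ->
                  In (s, m) (list_prod S (seq 0 (Datatypes.S (length S))))).
  { intros s m [t' n] Ds Htu [[H _] | [[_ [H H']] | [Hm [_ [Hd (l & Hnd & Hlen & Hl)]]]]];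
      cbn [fst snd] in *.
    - subst; exfalso; apply (tree_lt_irrefl le Htree t'), (tree_lt_trans le Htree _ t); auto.
      eapply frontier_ge; eauto; [apply Htu | apply Htree].
    - exfalso; apply (H' t); auto.
      eapply frontier_ge; eauto; [apply Htu | apply H].
    - subst m; assert (Hst : lt le s t).
      { eapply frontier_ge; eauto; [apply Htu | apply Hd]. }
      apply in_prod; [eauto |].
      assert (HI : incl l S).
      { intros u Hu; apply Hl in Hu; destruct Hu as [Hu Hus].
        apply (HS t'); auto; eapply tree_lt_trans; eauto. }
      apply (NoDup_incl_length Hnd) in HI; apply in_seq; lia. }
  (* An edge in the opposite orientation would give [le t' s], and then [t] would lie in [D]. *)
  intros [s m] [t' n] [H | H] Ds Htu; cbn [fst snd] in *; [| exact (key s m (t', n) Ds Htu H)].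
  exfalso.
  assert (Hle : le t' s -> False).
  { intro Hts; apply (proj1 Ft).
    apply (Ddown s); auto; eapply tree_lt_le_trans; eauto. }
  apply Hle.
  destruct H as [[H _] | [[_ H] | [_ [_ H]]]]; simpl in *.
  - rewrite H; apply Htree.
  - apply H.
  - apply H.
Qed.

(* The final vertex of the path pulls the whole path, except its first vertex, into the cone. *)
Lemma cone_path t x u q y :
  frontier le D t -> adj_chain E (x :: u :: q) -> final (x :: u :: q) = Some y -> le t (fst y) ->
  (forall v, In v (u :: q) -> ~ D (fst v)) -> E x u /\ le t (fst u).
Proof.
  intros Ft [Hxu Hc] Hfy Hy; split; auto; clear Hxu.
  change (x :: u :: q) with ([x] ++ u :: q) in Hfy; rewrite final_app in Hfy.
  revert u Hc Hfy H; induction q as [| w q IH]; intros u Hc Hfy H.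
  - injection Hfy as ->; auto.
  - destruct Hc as [Huw Hc].
    change (u :: w :: q) with ([u] ++ w :: q) in Hfy; rewrite final_app in Hfy.
    apply cone_step with w; auto using inflation_sym.
    + apply IH; auto; intros v Hv; apply H; simpl in *; tauto.
    + apply H; simpl; auto.
Qed.

End Frontier.

Lemma adj_chain_rev (p : list (T * nat)) : adj_chain E p -> adj_chain E (rev p).
Proof.
  induction p as [| a p IH]; [auto |]; intro H.
  destruct p as [| b p]; [auto |]; destruct H as [Hab Hp]; simpl in *.
  rewrite <- app_assoc; apply adj_chain_app; [auto |].
  simpl; auto using inflation_sym.
Qed.

Section RayGraph.
Context {I : Type} (R : I -> nat -> T * nat) (Hdis : disjoint_rays E R).

(** By disjointness each vertex of [A] lies on at most one of the rays. *)
Lemma countable_rays_meeting (A : T * nat -> Prop) :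
  countable_set A -> countable_set (fun j => exists m, A (R j m)).
Proof.
  intro HA; apply (countable_sub _ (fun j => exists v, A v /\ exists m, R j m = v)).
  - intros j [m Hm]; eauto.
  - apply countable_bigcup; auto; intros v _; apply countable_at_most_one.
    intros j j' [m Hm] [m' Hm']; apply NNPP; intro N.
    apply (proj2 Hdis j j' N m m'); congruence.
Qed.

Lemma ray_graph_countable_degree (H : I -> I -> Prop) (i : I) :
  ray_graph E R H -> countable_set (H i).
Proof.
  intros (Pset & Ppath & Pind & _ & PH).
  destruct (aronszajn_countable_hull (fun t => exists n, True /\ fst (R i n) = t))
    as (D & AD & Ddown & HD & HM).
  { apply countable_bigcup; [apply countable_nat |].
    intros n _; apply countable_at_most_one; congruence. }
  pose (D' := fun v : T * nat => D (fst v) \/ frontier le D (fst v)).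
  assert (HD' : countable_set D').
  { apply (countable_prod_nat (fun t => D t \/ frontier le D t)), countable_union; auto. }
  (* The exceptional neighbours: either [R j] meets [D'], or it meets a path of [Pset] with an inner
     vertex in [D']. By independence a vertex is inner to at most one path, so both kinds are
     countably many. *)
  apply (countable_sub _ (fun j => (exists m, D' (R j m)) \/
     exists v, D' v /\ exists p, (Pset p /\ inner p v) /\ exists m, In (R j m) p)).
  2: { apply countable_union; [apply countable_rays_meeting; auto |].
       apply countable_bigcup; auto; intros v _; apply countable_bigcup.
       - apply countable_at_most_one; intros p q [Pp Ip] [Pq Iq]; apply NNPP; intro N.
         apply (Pind p q Pp Pq N v Ip), Iq.
       - intros p _; apply (countable_rays_meeting (fun v => In v p)), countable_list. }
  intros j Hij; apply NNPP; intro N.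
  assert (Nj : forall m, ~ D' (R j m)) by eauto.
  assert (Nin : forall p v m, Pset p -> inner p v -> In (R j m) p -> ~ D' v).
  { intros p v m Pp Ip Hp Hv; apply N; right; exists v; split; auto; exists p; eauto. }
  destruct (frontier_le le Htree D (fst (R j 0))) as (t & Ft & Ht0).
  { intro; apply (Nj 0); left; auto. }
  (* The ray [R j] starts in the cone above [t] and, never meeting [D], cannot leave it. *)
  assert (Ht : forall m, le t (fst (R j m))).
  { induction m; auto; apply (cone_step D t (R j m)); auto.
    - apply Hdis.
    - intro; apply (Nj (S m)); left; auto. }
  destruct (cone_neighbours_finite D Ddown t Ft) as [L HL].
  destruct (PH i j Hij) as (f & Pf & ABf & fdis).
  assert (Hx : forall k, exists x, In x (f k) /\ In x L).
  { intro k.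
    (* The path is oriented from [R i] to [R j], reversing it if necessary. *)
    assert (Hp : exists p x y, adj_chain E p /\ first p = Some x /\ final p = Some y /\
      range (R i) x /\ range (R j) y /\ NoDup p /\
      (forall v, In v p <-> In v (f k)) /\ forall v, inner p v -> inner (f k) v).
    { destruct (ABf k) as [[[_ [Hn Hc]] (x & y & Hf & Hl & Rx & Ry & _)] |
                           [[_ [Hn Hc]] (y & x & Hf & Hl & Ry & Rx & _)]].
      - exists (f k), x, y; repeat split; auto; apply H0.
      - exists (rev (f k)), x, y; repeat split; auto using adj_chain_rev.
        + unfold final; rewrite rev_involutive; auto.
        + apply NoDup_rev; auto.
        + intro Hv; apply in_rev; auto.
        + intro Hv; apply in_rev in Hv; auto.
        + apply in_rev, H0.
        + destruct H0 as (_ & _ & H0); unfold final in H0; rewrite rev_involutive in H0; auto.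
        + apply H0. }
    destruct Hp as (p & x & y & Hc & Hf & Hl & [a Ra] & [b Rb] & Hnd & Hin & Hinn).
    assert (Dx : D (fst x)) by (apply AD; exists a; rewrite Ra; auto).
    assert (Hyp : In y (f k)).
    { apply Hin; apply in_rev; unfold final in Hl; destruct (rev p); [discriminate |].
      injection Hl as ->; simpl; auto. }
    destruct p as [| x' [| u q]]; [discriminate | |]; injection Hf as ->.
    { exfalso; injection Hl as ->; apply (Nj b); left; rewrite Rb; auto. }
    assert (out : forall v, In v (u :: q) -> ~ D' v).
    { intros v Hv; destruct (classic (v = y)) as [-> | Ny]; [rewrite <- Rb; auto |].
      apply (Nin (f k) v b); auto; [| rewrite Rb; auto].
      apply Hinn; split; [simpl in *; tauto | split].
      - intro Exv; injection Exv as ->; inversion Hnd; auto.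
      - rewrite Hl; congruence. }
    destruct (cone_path D t x u q y Ft Hc Hl) as [Hxu Htu].
    - rewrite <- Rb; auto.
    - intros v Hv Dv; apply (out v Hv); left; auto.
    - exists x; split; [apply Hin; simpl; auto |].
      (* [u] lies strictly above [t]: it avoids [D'], which contains the frontier and hence the
         column of [t]. *)
      apply (HL x u); auto; split; auto.
      intros ->; apply (out u); [simpl | right]; auto. }
  apply choice in Hx; destruct Hx as [x Hx].
  (* Disjoint paths contribute distinct vertices [x k], too many for the finite list [L]. *)
  destruct (injection_leaves_list x L 0) as (n & _ & Hn).
  - intros k l Ekl; apply NNPP; intro Nkl; apply (fdis k l Nkl (x k)); [apply Hx |].
    rewrite Ekl; apply Hx.
  - apply Hn, Hx.
Qed.

End RayGraph.

End Aronszajn.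

(** * The end of the columns and its degree *)

Theorem theorem6p6 (T : Type) (le : T -> T -> Prop) (G : T -> T -> Prop) :
  aronszajn_tree le ->
  T_graph le G ->
  sparse le G ->
  (forall t : T, exists S : list T,
      (forall s, In s S -> lt le s t) /\
      (forall t' s, lt le t t' -> down_nb le G t' s -> lt le s t -> In s S)) ->
  exists r0 : nat -> T * nat,
    is_ray (ray_inflation le G) r0 /\
    end_degree_aleph1 (ray_inflation le G) r0 /\
    (forall (I : Type) (R : I -> nat -> T * nat),
        card_aleph1 I ->
        disjoint_rays (ray_inflation le G) R ->
        (forall i, ray_equiv (ray_inflation le G) (R i) r0) ->
        ~ (exists H : I -> I -> Prop,
              simple_graph H /\ connected_graph H /\
              ray_graph (ray_inflation le G) R H)).
Proof.
  intros Haron _ Hsparse Hfin.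
  destruct (proj1 Haron) as (_ & (r & Hr & _) & _).
  exists (column r); split; [apply column_is_ray | split; [split |]].
  - exists T, column; split; [apply Haron | split; [split |]].
    + apply column_is_ray.
    + intros t t' N m n H; injection H; auto.
    + intro t; apply ray_equiv_of_linked; intro X.
      apply (columns_linked le Haron G r Hsparse Hr t X).
  (* Disjoint rays have distinct first vertices, so the number of vertices bounds the degree. *)
  - intros I R [_ Hdis] _; apply (card_le_aleph1_inj (fun i => R i 0)).
    + intros i j H; apply NNPP; intro N; apply (Hdis i j N 0 0 H).
    + apply card_le_aleph1_prod_nat, Haron.
  - intros I R [_ Hunc] Hdis _ (H & _ & Hconn & HG).
    apply Hunc, (countable_connected H Hconn); intro i.
    apply (ray_graph_countable_degree le Haron G Hfin R Hdis H i HG).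
Qed.
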